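(* Let $\mathbb{T}=\mathbb{R}/\mathbb{Z}$, $a=1/2$, fix $0<\rho<1/20$, and let $\omega(r):=\sin(\log\log(1/r))$ for $0<r<\rho$. Let $A\neq 0$ satisfy $2|A|\rho^2\le 1/4$. Let $V\in C^3(\mathbb{T})$ satisfy $V(x)=\tfrac12 x^2+Ax^4\omega(|x|)$ for $|x|<\rho$ (with $V(0)=0$), $V(x)=\tfrac12(x-a)^2-A(x-a)^4\omega(|x-a|)$ for $|x-a|<\rho$ (with $V(a)=0$), and $V(x)>0$ for all $x\in\mathbb{T}\setminus\{0,a\}$. Set $F:=-V$. For $\varepsilon\in(0,1)$, let $c(\varepsilon)\in\mathbb{R}$ be the unique constant for which the ergodic problem $$\tfrac12|(\phi^\varepsilon)'|^2+F(x)-\varepsilon(\phi^\varepsilon)''=c(\varepsilon)\quad\text{on }\mathbb{T}$$ admits a solution, and let $\phi^\varepsilon$ be the unique solution normalized by $\phi^\varepsilon(0)=0$. Then the family $\{\phi^\varepsilon\}_{\varepsilon\in(0,1)}$ does not converge in $C(\mathbb{T})$ as $\varepsilon\to0$.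
   Context: Periodic functions on $\mathbb{R}$ are identified with functions on $\mathbb{T}$; intervals are understood in the periodic sense. The solution $\phi^\varepsilon$ is unique up to an additive constant, which is fixed by $\phi^\varepsilon(0)=0$. *)

(* Defs.v *)
From Stdlib Require Import Reals Lra.
From Coquelicot Require Import Coquelicot.
Open Scope R_scope.

(* 1-periodic functions on R, identified with functions on T = R/Z *)
Definition periodic1 (f : R -> R) : Prop := forall x, f (x + 1) = f x.

Definition Cn (n : nat) (f : R -> R) : Prop :=
  (forall (k : nat) (x : R), (k <= n)%nat -> ex_derive_n f k x) /\
  (forall x, continuous (Derive_n f n) x).

Definition omega (r : R) : R := sin (ln (ln (/ r))).

Definition cong1 (x y : R) : Prop := exists k : Z, x = y + IZR k.

Definition solves_ergodic (F : R -> R) (eps c : R) (phi : R -> R) : Prop :=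
  (forall x, ex_derive phi x /\ ex_derive (Derive phi) x) /\
  (forall x, / 2 * (Derive phi x) ^ 2 + F x - eps * Derive_n phi 2 x = c).

Definition converges_CT (phi : R -> R -> R) : Prop :=
  exists g : R -> R, periodic1 g /\ (forall x, continuous g x) /\
    forall eta, 0 < eta -> exists delta, 0 < delta /\
      forall eps, 0 < eps < 1 -> eps < delta ->
        forall x, Rabs (phi eps x - g x) < eta.

(* Main.v *)
(* Put [lam = - c] and [psi = exp (- phi / (2 eps))]: then [2 eps^2 psi'' = (V - lam) psi], so [psi]
   is the ground state of a double well. At the wells [0] and [1/2] the local ground levels are
   [eps] plus a correction of order [eps^2] with the sign of [A omega (sqrt eps)], resp. its
   opposite. As [omega] is a slowly varying oscillation, for suitable arbitrarily small [eps] it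
   keeps a prescribed sign on all of [[eps, eps^(1/4)]]. An explicit trial function at the lower
   well then gives [lam <= eps - 6 b eps^2], and this forces [psi] to increase from the upper well
   to the lower one, with [phi] dropping by at least a fixed amount. For one choice of sign a
   limit [g] would satisfy [g (1/2) < g 0], for the other [g 0 < g (1/2)]. *)
Require Import Defs.
From Stdlib Require Import Reals Psatz.
From Coquelicot Require Import Coquelicot.
Open Scope R_scope.

(** * The ergodic equation, its reflections, and Wronskian comparison *)

Lemma nondecreasing_of_derive (f df : R -> R) (a b : R) :
  a <= b ->
  (forall x, a <= x <= b -> is_derive f x (df x)) ->
  (forall x, a <= x <= b -> 0 <= df x) -> f a <= f b.
Proof.
  intros Hab Hd Hp.
  destruct (MVT_gen f a b df) as [c [Hc E]].
  - intros x Hx. apply Hd. rewrite Rmin_left, Rmax_right in Hx; lra.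
  - intros x Hx. rewrite Rmin_left, Rmax_right in Hx by lra.
    apply continuity_pt_filterlim.
    apply (ex_derive_continuous (V := R_NormedModule)).
    exists (df x). apply Hd; lra.
  - rewrite Rmin_left, Rmax_right in Hc by lra.
    specialize (Hp c Hc). nra.
Qed.

(** [p1] and [p2] are carried as explicit derivatives, so that translates and reflections keep
    closed formulas. [lam] stands for [- c] and [U] for [V] or its image under such a map. Read for
    [p1], this is a Riccati equation. *)
Definition ergodic_sol (eps lam : R) (U p0 p1 p2 : R -> R) : Prop :=
  (forall x, is_derive p0 x (p1 x)) /\ (forall x, is_derive p1 x (p2 x)) /\
  (forall x, / 2 * p1 x ^ 2 - eps * p2 x = U x - lam).

(** The equation is even in [p1], so a reflection is as good as a translation. This serves to put a
    well at the origin and to choose the side of it on which the slope has the wanted sign. *)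
Lemma ergodic_sol_affine (eps lam z s : R) (U p0 p1 p2 : R -> R) :
  s * s = 1 -> ergodic_sol eps lam U p0 p1 p2 ->
  ergodic_sol eps lam (fun x => U (z + s * x)) (fun x => p0 (z + s * x))
    (fun x => s * p1 (z + s * x)) (fun x => p2 (z + s * x)).
Proof.
  intros Hs [H0 [H1 H2]].
  assert (Haff : forall x, is_derive (fun y => z + s * y) x s)
    by (intros x; auto_derive; [trivial | ring]).
  split; [|split].
  - intros x. exact (is_derive_comp p0 _ x _ _ (H0 _) (Haff x)).
  - intros x.
    replace (p2 (z + s * x)) with (s * (s * p2 (z + s * x)))
      by (rewrite <- Rmult_assoc, Hs; ring).
    apply is_derive_scal.
    exact (is_derive_comp p1 _ x _ _ (H1 _) (Haff x)).
  - intros x. rewrite <- H2.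
    replace ((s * p1 (z + s * x)) ^ 2) with ((s * s) * p1 (z + s * x) ^ 2) by ring.
    rewrite Hs. ring.
Qed.

(* [exp (- (p0 + w0) / (2 eps)) * (w1 - p1)] is, up to the factor [2 eps], the Wronskian of
   [exp (- p0 / (2 eps))] and [exp (- w0 / (2 eps))]. *)
Lemma derive_comparison (eps lam : R) (U p0 p1 p2 w0 w1 w2 : R -> R) (x0 x1 : R) :
  0 < eps -> x0 <= x1 -> ergodic_sol eps lam U p0 p1 p2 ->
  (forall x, is_derive w0 x (w1 x)) -> (forall x, is_derive w1 x (w2 x)) ->
  (forall x, x0 <= x <= x1 -> / 2 * w1 x ^ 2 - eps * w2 x <= U x - lam) ->
  p1 x0 <= w1 x0 -> p1 x1 <= w1 x1.
Proof.
  intros He Hx [H0 [H1 H2]] Hw0 Hw1 Hle Hini.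
  (* Differentiating the exponential produces a difference of squares, so [W'] is the difference
     between [U - lam] and the left side for [w0], times a positive factor. *)
  pose (W := fun x => exp (- (p0 x + w0 x) / (2 * eps)) * (w1 x - p1 x)).
  assert (HW : W x0 <= W x1).
  { apply (nondecreasing_of_derive W (fun x => exp (- (p0 x + w0 x) / (2 * eps)) / eps *
      ((U x - lam) - (/ 2 * w1 x ^ 2 - eps * w2 x)))); [exact Hx| |].
    - intros x _. unfold W. rewrite <- H2.
      assert (D0 := H0 x). assert (D1 := H1 x). assert (E0 := Hw0 x). assert (E1 := Hw1 x).
      auto_derive.
      + repeat split; trivial; eexists; eassumption.
      + replace (Derive (fun x1 => p0 x1) x) with (p1 x) by (symmetry; now apply is_derive_unique).
        replace (Derive (fun x1 => p1 x1) x) with (p2 x) by (symmetry; now apply is_derive_unique).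
        replace (Derive (fun x1 => w0 x1) x) with (w1 x) by (symmetry; now apply is_derive_unique).
        replace (Derive (fun x1 => w1 x1) x) with (w2 x) by (symmetry; now apply is_derive_unique).
        unfold Rdiv. field. lra.
    - intros x Hxx. specialize (Hle x Hxx).
      apply Rmult_le_pos; [|lra].
      apply Rlt_le, Rdiv_lt_0_compat; [apply exp_pos | exact He]. }
  unfold W in HW.
  assert (P0 := exp_pos (- (p0 x0 + w0 x0) / (2 * eps))).
  assert (P1 := exp_pos (- (p0 x1 + w0 x1) / (2 * eps))).
  nra.
Qed.

(* [psi = exp (- p0 / (2 eps))] solves [2 eps^2 psi'' = (U - lam) psi], and
   [f = h exp (- y^2 / (4 eps))] is a positive subsolution for the level [eps - k eps^2]
   vanishing at [q]. The Wronskian of the two forbids [lam] to be larger. *)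
Lemma eigenvalue_upper_bound (eps lam k q : R) (U p0 p1 p2 h h1 h2 : R -> R) :
  0 < eps -> 0 < q -> ergodic_sol eps lam U p0 p1 p2 ->
  (forall x, is_derive h x (h1 x)) -> (forall x, is_derive h1 x (h2 x)) ->
  (forall y, 0 <= y <= q -> 0 <= h y) ->
  h1 0 = 0 -> h q = 0 -> h1 q < 0 ->
  (forall y, 0 <= y <= q ->
     h y * (k * eps ^ 2 + U y - / 2 * y ^ 2) + eps * (2 * y * h1 y - 2 * eps * h2 y) <= 0) ->
  0 <= p1 0 -> lam <= eps - k * eps ^ 2.
Proof.
  intros He Hq [H0 [H1 H2]] Hh Hh1 Hpos Hh10 Hhq Hh1q Hle Hini.
  destruct (Rle_or_lt lam (eps - k * eps ^ 2)) as [Hl|Hl]; [exact Hl|exfalso].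
  pose (E := fun x => exp (- (p0 x + / 2 * x ^ 2) / (2 * eps))).
  (* [W] is [2 eps (psi f' - psi' f)]. It is nondecreasing when [lam > eps - k eps^2], whereas
     [h1 0 = 0] and [0 <= p1 0] give [0 <= W 0], and [h q = 0] with [h1 q < 0] gives [W q < 0]. *)
  pose (W := fun x => exp (- (p0 x + / 2 * x ^ 2) / (2 * eps)) *
                      (2 * eps * h1 x - (x - p1 x) * h x)).
  assert (HW : W 0 <= W q).
  { apply (nondecreasing_of_derive W (fun x => E x / eps *
      - (h x * (U x - lam - / 2 * x ^ 2 + eps) + eps * (2 * x * h1 x - 2 * eps * h2 x))));
      [lra| |].
    - intros x _. unfold W, E. rewrite <- H2.
      assert (D0 := H0 x). assert (D1 := H1 x). assert (E0 := Hh x). assert (E1 := Hh1 x).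
      auto_derive.
      + repeat split; trivial; eexists; eassumption.
      + replace (Derive (fun x1 => p0 x1) x) with (p1 x) by (symmetry; now apply is_derive_unique).
        replace (Derive (fun x1 => p1 x1) x) with (p2 x) by (symmetry; now apply is_derive_unique).
        replace (Derive (fun x1 => h x1) x) with (h1 x) by (symmetry; now apply is_derive_unique).
        replace (Derive (fun x1 => h1 x1) x) with (h2 x) by (symmetry; now apply is_derive_unique).
        replace (- (p0 x + / 2 * (x * (x * 1))) * / (2 * eps))
          with (- (p0 x + / 2 * x ^ 2) / (2 * eps)) by (unfold Rdiv; ring).
        generalize (exp (- (p0 x + / 2 * x ^ 2) / (2 * eps))); intros e.
        field. lra.
    - intros x Hx. specialize (Hle x Hx). specialize (Hpos x Hx).
      apply Rmult_le_pos.
      + apply Rlt_le, Rdiv_lt_0_compat; [apply exp_pos | exact He].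
      + nra. }
  unfold W in HW. rewrite Hh10, Hhq in HW.
  assert (P0 := exp_pos (- (p0 0 + / 2 * 0 ^ 2) / (2 * eps))).
  assert (P1 := exp_pos (- (p0 q + / 2 * q ^ 2) / (2 * eps))).
  assert (Hh0 : 0 <= h 0) by (apply Hpos; lra).
  assert (0 <= exp (- (p0 0 + / 2 * 0 ^ 2) / (2 * eps)) * (2 * eps * 0 - (0 - p1 0) * h 0)).
  { apply Rmult_le_pos; [lra|]. assert (0 <= p1 0 * h 0) by (apply Rmult_le_pos; lra). lra. }
  assert (0 < exp (- (p0 q + / 2 * q ^ 2) / (2 * eps)) * (- (2 * eps * h1 q))).
  { apply Rmult_lt_0_compat; [lra|]. nra. }
  nra.
Qed.

(** * Plateaus of [omega] and the two model wells *)

(** In the variable [ln (ln (/ x))] the interval from [q ^ 4] to [q] has length only [ln 4]. Centred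
    at a peak of [sg * sin], it stays within [ln 2 < 1 < PI / 3] of the peak, where the value is at
    least [cos (PI / 3) = / 2]. *)
Lemma omega_plateau (sg q0 : R) :
  sg = 1 \/ sg = -1 -> 0 < q0 ->
  exists q, 0 < q < q0 /\ forall x, q ^ 4 <= x <= q -> / 2 <= sg * omega x.
Proof.
  intros Hsg Hq0.
  destruct (INR_unbounded (Rmax 1 (-2 * ln q0))) as [n Hn].
  assert (Hpi : 3 < PI) by (generalize PI2_3_2; lra).
  assert (HM1 := Rmax_l 1 (-2 * ln q0)). assert (HM2 := Rmax_r 1 (-2 * ln q0)).
  (* [T] is a peak of [sg * sin]. As [L = exp T] exceeds [-2 * ln q0], the witness [exp (- (L / 2))]
     lies below [q0], and [- ln x] runs over [[L / 2, 2 L]]. *)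
  set (T := sg * (PI / 2) + 2 * INR n * PI).
  set (L := exp T).
  assert (HL : -2 * ln q0 < L).
  { apply Rlt_trans with (INR n); [lra|].
    apply Rlt_trans with (1 + T).
    - unfold T. destruct Hsg; subst sg; nra.
    - apply exp_ineq1. unfold T. destruct Hsg; subst sg; nra. }
  assert (HLp : 0 < L) by apply exp_pos.
  exists (exp (- (L / 2))). split; [split|].
  - apply exp_pos.
  - rewrite <- (exp_ln q0) by exact Hq0. apply exp_increasing. lra.
  - intros x [Hx1 Hx2].
    assert (E4 : exp (- (L / 2)) ^ 4 = exp (- (2 * L))).
    { simpl. rewrite Rmult_1_r, <- !exp_plus. f_equal. field. }
    rewrite E4 in Hx1.
    assert (Hx : 0 < x) by (generalize (exp_pos (- (2 * L))); lra).
    assert (Ha : - (2 * L) <= ln x).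
    { rewrite <- (ln_exp (- (2 * L))). apply ln_le; [apply exp_pos | exact Hx1]. }
    assert (Hb : ln x <= - (L / 2)).
    { rewrite <- (ln_exp (- (L / 2))). apply ln_le; assumption. }
    unfold omega. rewrite ln_Rinv by exact Hx.
    assert (Hln2 : ln 2 < 1).
    { rewrite <- (ln_exp 1). apply ln_increasing; [lra|].
      generalize (exp_ineq1 1); lra. }
    assert (Hc : ln (- ln x) <= T + 1).
    { apply Rle_trans with (ln (2 * L)); [apply ln_le; lra|].
      rewrite ln_mult by lra. unfold L. rewrite ln_exp. lra. }
    assert (Hd : T - 1 <= ln (- ln x)).
    { apply Rle_trans with (ln (L * / 2)); [|apply ln_le; lra].
      rewrite ln_mult by lra. rewrite ln_Rinv by lra. unfold L. rewrite ln_exp. lra. }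
    set (th := ln (- ln x) - T).
    replace (ln (- ln x)) with (th + sg * (PI / 2) + 2 * INR n * PI) by (unfold th, T; ring).
    rewrite sin_period.
    assert (Es : sg * sin (th + sg * (PI / 2)) = cos th).
    { destruct Hsg; subst sg.
      - rewrite !Rmult_1_l, sin_plus, cos_PI2, sin_PI2. ring.
      - replace (th + -1 * (PI / 2)) with (th - PI / 2) by ring.
        rewrite sin_minus, cos_PI2, sin_PI2. ring. }
    rewrite Es.
    assert (Hth : -1 <= th <= 1) by (unfold th; lra).
    replace (/ 2) with (1 / 2) by lra.
    destruct (Rle_or_lt 0 th).
    + rewrite <- cos_PI3. apply cos_decr_1; lra.
    + rewrite <- cos_PI3, <- (cos_neg th). apply cos_decr_1; lra.
Qed.

(* In the variable [t = y^2 / eps] the trial function is [h = 1 + b eps (6 t + t^2) - d eps^3 t^3]: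
   [6 t + t^2] cancels the quartic term of the potential, and the cubic term, negligible
   at the scale [t = O(1)], brings [h] down to [0] at [y = q], where [t = 1 / q^2]. *)
Lemma eigenvalue_low_well (a b q lam : R) (U p0 p1 p2 : R -> R) :
  0 < b -> b <= / 20 -> 272 * b <= a -> 0 < q -> q < 1 -> q * 3 <= b ->
  (2 * a + 68 * b) * q <= 12 * b ->
  ergodic_sol (q ^ 4) lam U p0 p1 p2 ->
  (forall y, q ^ 4 <= y <= q -> U y <= / 2 * y ^ 2 - / 2 * a * y ^ 4) ->
  (forall y, 0 <= y <= q ^ 4 -> U y <= / 2 * y ^ 2 + a * y ^ 4) ->
  0 <= p1 0 -> lam <= q ^ 4 - 6 * b * (q ^ 4) ^ 2.
Proof.
  intros Hb Hb' Hab Hq Hq1 Hqb Hqa HS Hout Hin Hini.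
  set (e := q ^ 4) in *.
  assert (Hq2 : 0 < q ^ 2 < 1) by nra.
  assert (He : 0 < e < 1) by (unfold e; nra).
  assert (Heq : e <= q).
  { unfold e. replace (q ^ 4) with (q * (q * q ^ 2)) by ring.
    assert (q * q ^ 2 <= 1) by nra. nra. }
  pose (d := (1 + b + 6 * b * q ^ 2) / q ^ 6).
  assert (Hq6 : 0 < q ^ 6) by (apply pow_lt; lra).
  assert (Hd : 0 < d) by (unfold d; apply Rdiv_lt_0_compat; nra).
  assert (Hdq : d * q ^ 6 = 1 + b + 6 * b * q ^ 2) by (unfold d; field; lra).
  assert (Hde : d * e ^ 2 <= b).
  { replace (d * e ^ 2) with (d * q ^ 6 * q ^ 2) by (unfold e; ring).
    rewrite Hdq. assert (1 + b + 6 * b * q ^ 2 <= 3) by nra. nra. }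
  assert (Hnn : forall y, 0 <= y <= q -> 0 <= 1 + b * (6 * y ^ 2 + y ^ 4 / e) - d * y ^ 6).
  { intros y Hy.
    set (X := y ^ 2). set (Q := q ^ 2) in *.
    assert (HX : 0 <= X <= Q) by (unfold X, Q; split; nra).
    replace (y ^ 4) with (X ^ 2) by (unfold X; ring).
    replace (y ^ 6) with (X ^ 3) by (unfold X; ring).
    replace (q ^ 6) with (Q ^ 3) in * by (unfold Q; ring).
    replace e with (Q ^ 2) in * by (unfold e, Q; ring).
    (* Multiplying by [Q ^ 3] and inserting the value of [d Q^3] leaves only differences of powers
       of [Q] and [X], nonnegative since [X <= Q]. *)
    assert (G : 0 <= Q ^ 3 * (1 + b * (6 * X + X ^ 2 / Q ^ 2) - d * X ^ 3)).
    { replace (Q ^ 3 * (1 + b * (6 * X + X ^ 2 / Q ^ 2) - d * X ^ 3))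
        with ((Q ^ 3 - X ^ 3) + b * X ^ 2 * (Q - X) + 6 * b * (X * Q * ((Q + X) * (Q - X)))).
      - assert (X ^ 3 <= Q ^ 3) by (apply pow_incr; lra).
        assert (0 <= b * X ^ 2 * (Q - X)) by (apply Rmult_le_pos; [apply Rmult_le_pos; nra | lra]).
        assert (0 <= X * Q * ((Q + X) * (Q - X)))
          by (apply Rmult_le_pos; apply Rmult_le_pos; lra).
        nra.
      - replace (Q ^ 3 * (1 + b * (6 * X + X ^ 2 / Q ^ 2) - d * X ^ 3))
          with (Q ^ 3 * (1 + b * (6 * X + X ^ 2 / Q ^ 2)) - d * Q ^ 3 * X ^ 3) by ring.
        rewrite Hdq. field. lra. }
    apply Rmult_le_reg_l with (Q ^ 3); lra. }
  apply (eigenvalue_upper_bound e lam (6 * b) q U p0 p1 p2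
    (fun y => 1 + b * (6 * y ^ 2 + y ^ 4 / e) - d * y ^ 6)
    (fun y => b * (12 * y + 4 * y ^ 3 / e) - 6 * d * y ^ 5)
    (fun y => b * (12 + 12 * y ^ 2 / e) - 30 * d * y ^ 4)); trivial; try lra.
  - intros x. auto_derive; [trivial|]. simpl. field. lra.
  - intros x. auto_derive; [trivial|]. simpl. field. lra.
  - rewrite Hdq. unfold e. field. lra.
  - apply Rmult_lt_reg_l with q; [exact Hq|].
    replace (q * (b * (12 * q + 4 * q ^ 3 / e) - 6 * d * q ^ 5))
      with (12 * b * q ^ 2 + 4 * b - 6 * (d * q ^ 6)) by (unfold e; field; lra).
    rewrite Hdq. nra.
  - intros y Hy.
    set (t := y ^ 2 / e).
    assert (Ey2 : y ^ 2 = e * t) by (unfold t; field; lra).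
    assert (Ey4 : y ^ 4 = e ^ 2 * t ^ 2) by (replace (y ^ 4) with ((y ^ 2) ^ 2) by ring; rewrite Ey2; ring).
    assert (Ey6 : y ^ 6 = e ^ 3 * t ^ 3) by (replace (y ^ 6) with ((y ^ 2) ^ 3) by ring; rewrite Ey2; ring).
    assert (Ht : 0 <= t) by (unfold t; apply Rmult_le_pos; [nra | apply Rlt_le, Rinv_0_lt_compat; lra]).
    assert (Het : e * t <= q ^ 2) by (rewrite <- Ey2; nra).
    assert (Het2 : e * t ^ 2 <= 1).
    { apply Rmult_le_reg_l with e; [lra|].
      replace (e * (e * t ^ 2)) with ((e * t) ^ 2) by ring.
      replace (e * 1) with ((q ^ 2) ^ 2) by (unfold e; ring).
      apply pow_incr. nra. }
    set (tau := d * e ^ 2) in *.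
    assert (Htau : 0 < tau) by (unfold tau; apply Rmult_lt_0_compat; [lra | nra]).
    set (H := 1 + b * (6 * y ^ 2 + y ^ 4 / e) - d * y ^ 6).
    assert (EH : H = 1 + b * (6 * (e * t) + e * t ^ 2) - tau * e * t ^ 3).
    { unfold H, tau. rewrite Ey2, Ey4, Ey6. field. lra. }
    assert (HH2 : H <= 2).
    { rewrite EH. assert (0 <= tau * e * t ^ 3)
        by (apply Rmult_le_pos; [apply Rmult_le_pos; lra | apply pow_le; lra]).
      assert (b * (6 * (e * t) + e * t ^ 2) <= b * 7) by (apply Rmult_le_compat_l; lra). lra. }
    replace (e * (2 * y * (b * (12 * y + 4 * y ^ 3 / e) - 6 * d * y ^ 5) -
        2 * e * (b * (12 + 12 * y ^ 2 / e) - 30 * d * y ^ 4)))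
      with (e ^ 2 * (- 24 * b + (8 * b + 60 * tau) * t ^ 2 - 12 * tau * t ^ 3)).
    2: { transitivity (e * (24 * b * y ^ 2 + 8 * b * y ^ 4 / e - 12 * d * y ^ 6
             - 24 * b * e - 24 * b * y ^ 2 + 60 * d * e * y ^ 4)); [|field; lra].
         rewrite Ey2, Ey4, Ey6. unfold tau. field. lra. }
    assert (Hpos : 0 <= H) by (apply Hnn; exact Hy).
    assert (Ht2 : 0 <= t ^ 2) by nra. assert (Ht3 : 0 <= t ^ 3) by (apply pow_le; lra).
    assert (Hbt : (8 * b + 60 * tau) * t ^ 2 <= 68 * b * t ^ 2)
      by (apply Rmult_le_compat_r; lra).
    (* For [y >= e] the quartic gain [- a y^4 / 2] is available. For [y < e] the quartic term may
       have the wrong sign, but [t <= e] makes it small against [- 24 b]. *)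
    destruct (Rle_or_lt e y) as [Hey|Hey].
    + assert (HU := Hout y (conj Hey (proj2 Hy))). rewrite Ey4 in HU.
      assert (G : H * (6 * b - / 2 * a * t ^ 2)
        + (- 24 * b + (8 * b + 60 * tau) * t ^ 2 - 12 * tau * t ^ 3) <= 0).
      { assert (H * (6 * b) <= 12 * b) by nra.
        (* If [H >= / 2], the quartic gain absorbs [68 b t^2]; here [68 = 8 + 60] comes from
           [tau <= b], and [272 = 4 * 68]. If [H < / 2], the cubic term is already large,
           [e tau t^3 >= / 2], and absorbs it instead. *)
        destruct (Rle_or_lt (/ 2) H) as [Hh|Hh].
        - assert (68 * b * t ^ 2 <= H * (/ 2 * a * t ^ 2)).
          { apply Rle_trans with (/ 2 * (/ 2 * a * t ^ 2)); [nra|].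
            apply Rmult_le_compat_r; nra. }
          assert (0 <= tau * t ^ 3) by (apply Rmult_le_pos; lra). lra.
        - assert (Hbig : / 2 <= e * (tau * t ^ 3)).
          { rewrite EH in Hh. assert (0 <= b * (6 * (e * t) + e * t ^ 2)) by (apply Rmult_le_pos; nra).
            lra. }
          assert (68 * b * t ^ 2 <= 12 * (tau * t ^ 3)).
          { apply Rmult_le_reg_l with e; [lra|].
            assert (b * (e * t ^ 2) <= / 20) by nra. lra. }
          assert (0 <= H * (/ 2 * a * t ^ 2)) by (apply Rmult_le_pos; nra).
          lra. }
      apply Rle_trans with (e ^ 2 * (H * (6 * b - / 2 * a * t ^ 2)
        + (- 24 * b + (8 * b + 60 * tau) * t ^ 2 - 12 * tau * t ^ 3))); [|nra].
      rewrite Rmult_plus_distr_l. apply Rplus_le_compat_r.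
      replace (e ^ 2 * (H * (6 * b - / 2 * a * t ^ 2)))
        with (H * (6 * b * e ^ 2 - / 2 * a * (e ^ 2 * t ^ 2))) by ring.
      apply Rmult_le_compat_l; lra.
    + assert (HU := Hin y (conj (proj1 Hy) (Rlt_le _ _ Hey))). rewrite Ey4 in HU.
      assert (Hte : t ^ 2 <= q).
      { assert (t <= e). { apply Rmult_le_reg_l with e; [lra|]. rewrite <- Ey2. nra. }
        nra. }
      assert (G : H * (6 * b + a * t ^ 2)
        + (- 24 * b + (8 * b + 60 * tau) * t ^ 2 - 12 * tau * t ^ 3) <= 0).
      { assert (H * (6 * b + a * t ^ 2) <= 2 * (6 * b + a * t ^ 2))
          by (apply Rmult_le_compat_r; nra).
        assert ((2 * a + 68 * b) * t ^ 2 <= (2 * a + 68 * b) * q)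
          by (apply Rmult_le_compat_l; lra).
        assert (0 <= tau * t ^ 3) by (apply Rmult_le_pos; lra). lra. }
      apply Rle_trans with (e ^ 2 * (H * (6 * b + a * t ^ 2)
        + (- 24 * b + (8 * b + 60 * tau) * t ^ 2 - 12 * tau * t ^ 3))); [|nra].
      rewrite Rmult_plus_distr_l. apply Rplus_le_compat_r.
      replace (e ^ 2 * (H * (6 * b + a * t ^ 2)))
        with (H * (6 * b * e ^ 2 + a * (e ^ 2 * t ^ 2))) by ring.
      apply Rmult_le_compat_l; lra.
Qed.

(* With [lam] below the local harmonic level [eps], the slope leaves the decaying branch [x]:
   it stays under [w' = x - (k eps x + d x^7)], and [d] is chosen so that [w'] vanishes at [q]. *)
Lemma slope_high_well (a b q lam : R) (U p0 p1 p2 : R -> R) :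
  0 < b -> 0 < a -> 0 < q -> q < 1 -> 1000 * q <= b -> a * q <= 3 * b -> 3 * b * q <= 1 ->
  ergodic_sol (q ^ 4) lam U p0 p1 p2 ->
  (forall x, q ^ 4 <= x <= q -> / 2 * x ^ 2 <= U x) ->
  (forall x, 0 <= x <= q ^ 4 -> / 2 * x ^ 2 - a * x ^ 4 <= U x) ->
  lam <= q ^ 4 - 6 * b * (q ^ 4) ^ 2 ->
  p1 0 <= 0 -> p1 q <= 0.
Proof.
  intros Hb Ha Hq Hq1 Hqb Hqa Hqb' HS Hout Hin Hlam Hini.
  set (e := q ^ 4) in *.
  assert (Hq2 : 0 < q ^ 2 < 1) by nra.
  assert (He : 0 < e < 1) by (unfold e; nra).
  assert (Heq : e <= q).
  { unfold e. replace (q ^ 4) with (q * (q * q ^ 2)) by ring.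
    assert (q * q ^ 2 <= 1) by nra. nra. }
  (* Half of the level gain [6 b e^2] is kept as [k e^2]; the other half pays for the uncontrolled
     quartic term on [[0, q^4]]. *)
  set (k := 3 * b) in *.
  assert (Hk : 0 < k) by (unfold k; lra).
  assert (Hke : k * e <= 1) by nra.
  assert (Hq6 : 0 < q ^ 6) by (apply pow_lt; lra).
  pose (d := (1 - k * e) / q ^ 6).
  assert (Hd : 0 <= d) by (unfold d; apply Rmult_le_pos; [lra | apply Rlt_le, Rinv_0_lt_compat; lra]).
  assert (Hdq : d * q ^ 6 = 1 - k * e) by (unfold d; field; lra).
  assert (Hde : d * e ^ 2 <= q).
  { replace (d * e ^ 2) with (d * q ^ 6 * q ^ 2) by (unfold e; ring).
    rewrite Hdq. assert (0 <= k * e) by (unfold k; nra). nra. }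
  replace 0 with (q - (k * e * q + d * q ^ 7)).
  2: { replace (d * q ^ 7) with (d * q ^ 6 * q) by ring. rewrite Hdq. ring. }
  apply (derive_comparison e lam U p0 p1 p2
    (fun x => x ^ 2 / 2 - (k * e * x ^ 2 / 2 + d * x ^ 8 / 8))
    (fun x => x - (k * e * x + d * x ^ 7))
    (fun x => 1 - (k * e + 7 * d * x ^ 6)) 0 q); try lra; trivial.
  - intros x. auto_derive; [trivial|]. simpl. field.
  - intros x. auto_derive; [trivial|]. simpl. ring.
  - intros x Hx.
    assert (HU : / 2 * x ^ 2 - e + k * e ^ 2 <= U x - lam).
    { assert (0 <= b * e ^ 2) by nra.
      destruct (Rle_or_lt e x) as [Hex|Hex].
      - assert (HU := Hout x (conj Hex (proj2 Hx))). unfold k. lra.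
      - assert (HU := Hin x (conj (proj1 Hx) (Rlt_le _ _ Hex))).
        assert (a * x ^ 4 <= k * e ^ 2).
        { assert (x ^ 4 <= e ^ 4) by (apply pow_incr; lra).
          apply Rle_trans with (a * e ^ 4); [nra|].
          replace (a * e ^ 4) with (a * e ^ 2 * e ^ 2) by ring.
          apply Rmult_le_compat_r; [nra|].
          assert (e ^ 2 <= e) by nra. nra. }
        unfold k in *. lra. }
    apply Rle_trans with (2 := HU).
    set (r := k * e + d * x ^ 6).
    assert (Hx6 : 0 <= x ^ 6) by (apply pow_le; lra).
    assert (Hr : 0 <= r <= 1).
    { unfold r. assert (x ^ 6 <= q ^ 6) by (apply pow_incr; lra).
      assert (0 <= d * x ^ 6) by nra. assert (0 <= k * e) by (unfold k; nra). nra. }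
    replace (x - (k * e * x + d * x ^ 7)) with (x * (1 - r)) by (unfold r; ring).
    (* The comparison inequality reduces to this one because [r <= 1] gives [r ^ 2 <= r]. For
       [x ^ 2 >= 14 e] the part [d x^6] of [r] suffices; otherwise the part [k e] does, since
       [14 * 196 = 2744] and [2744 q <= 3 b]. *)
    assert (Hmain : 14 * (d * e * x ^ 6) <= r * x ^ 2).
    { destruct (Rle_or_lt (14 * e) (x ^ 2)) as [Hc|Hc].
      - assert (14 * e * (d * x ^ 6) <= x ^ 2 * (d * x ^ 6)) by (apply Rmult_le_compat_r; nra).
        assert (0 <= k * e * x ^ 2) by (unfold k; apply Rmult_le_pos; nra).
        unfold r. lra.
      - assert (x ^ 4 <= 196 * e ^ 2).
        { replace (x ^ 4) with ((x ^ 2) ^ 2) by ring. replace (196 * e ^ 2) with ((14 * e) ^ 2) by ring.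
          apply pow_incr. nra. }
        assert (14 * d * e * x ^ 4 <= k * e).
        { apply Rle_trans with (14 * d * e * (196 * e ^ 2)).
          - apply Rmult_le_compat_l; [nra | assumption].
          - replace (14 * d * e * (196 * e ^ 2)) with (2744 * (d * e ^ 2) * e) by ring.
            apply Rmult_le_compat_r; unfold k; lra. }
        assert (14 * d * e * x ^ 4 * x ^ 2 <= k * e * x ^ 2) by (apply Rmult_le_compat_r; nra).
        assert (0 <= d * x ^ 6 * x ^ 2) by (apply Rmult_le_pos; nra).
        unfold r. lra. }
    assert (r ^ 2 * x ^ 2 <= r * x ^ 2) by (apply Rmult_le_compat_r; nra).
    nra.
Qed.

(** * Behaviour of the solution between the wells *)

(** The parabola of slope [- al (x - r1)] satisfies the comparison inequality where [U - lam >= m].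
    Hence [p1] stays below that slope, and integrating gives the drop. *)
Lemma drop_of_confinement (eps lam m al r1 r2 : R) (U p0 p1 p2 : R -> R) :
  0 < eps -> r1 <= r2 -> ergodic_sol eps lam U p0 p1 p2 ->
  (forall x, r1 <= x <= r2 -> m <= U x - lam) ->
  / 2 * (al * (r2 - r1)) ^ 2 + eps * al <= m -> 0 <= al ->
  p1 r1 <= 0 -> p0 r2 <= p0 r1 - al * (r2 - r1) ^ 2 / 2.
Proof.
  intros He Hr HS Hm Hal Hal0 Hini.
  assert (Hp1 : forall x, r1 <= x <= r2 -> p1 x <= - (al * (x - r1))).
  { intros x Hx.
    apply (derive_comparison eps lam U p0 p1 p2 (fun y => - (al * (y - r1) ^ 2 / 2))
             (fun y => - (al * (y - r1))) (fun y => - al) r1 x); try lra; trivial.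
    - intros y. auto_derive; [trivial | field].
    - intros y. auto_derive; [trivial | ring].
    - intros y Hy. assert (Hmy := Hm y ltac:(lra)).
      assert ((al * (y - r1)) ^ 2 <= (al * (r2 - r1)) ^ 2) by (apply pow_incr; nra).
      lra. }
  assert (G : - p0 r1 - al * (r1 - r1) ^ 2 / 2 <= - p0 r2 - al * (r2 - r1) ^ 2 / 2).
  { apply (nondecreasing_of_derive (fun x => - p0 x - al * (x - r1) ^ 2 / 2)
             (fun x => - p1 x - al * (x - r1))); [exact Hr| |].
    - intros x _. assert (D := proj1 HS x).
      auto_derive; [eexists; eassumption|].
      replace (Derive (fun x1 => p0 x1) x) with (p1 x) by (symmetry; now apply is_derive_unique).
      field.
    - intros x Hx. specialize (Hp1 x Hx). lra. }
  replace (r1 - r1) with 0 in G by ring. lra.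
Qed.

(** The zero function satisfies the comparison inequality wherever [lam <= U], so a nonpositive
    slope remains nonpositive. *)
Lemma nonincreasing_of_confinement (eps lam z0 z1 : R) (U p0 p1 p2 : R -> R) :
  0 < eps -> ergodic_sol eps lam U p0 p1 p2 ->
  (forall x, z0 <= x <= z1 -> lam <= U x) -> p1 z0 <= 0 ->
  forall x y, z0 <= x -> x <= y -> y <= z1 -> p1 y <= 0 /\ p0 y <= p0 x.
Proof.
  intros He HS HU Hini.
  assert (Hp1 : forall y, z0 <= y <= z1 -> p1 y <= 0).
  { intros y Hy.
    apply (derive_comparison eps lam U p0 p1 p2 (fun _ => 0) (fun _ => 0) (fun _ => 0) z0 y);
      try lra; trivial; try (intros x; auto_derive; trivial).
    intros x Hx. specialize (HU x ltac:(lra)). lra. }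
  intros x y Hx Hxy Hy. split; [apply Hp1; lra|].
  apply Ropp_le_cancel.
  apply (nondecreasing_of_derive (fun t => - p0 t) (fun t => - p1 t)); [exact Hxy| |].
  - intros t _. apply (is_derive_opp p0). apply HS.
  - intros t Ht. specialize (Hp1 t ltac:(lra)). lra.
Qed.

(** * Periodicity, compactness, and the drop of the limit *)

(** Leaving [0] in direction [s] is, up to a period, approaching [/ 2] on its side [- s]; both
    halves of the circle are thus treated at once. *)
Lemma periodic1_opposite (f : R -> R) (s x : R) :
  periodic1 f -> s = 1 \/ s = -1 -> f (0 + s * x) = f (/ 2 + - s * (/ 2 - x)).
Proof.
  intros Hf [Hs|Hs]; subst s.
  - f_equal. lra.
  - rewrite <- (Hf (0 + -1 * x)). f_equal. lra.
Qed.

Lemma positive_lower_bound (f : R -> R) (u v : R) :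
  u <= v -> (forall x, continuous f x) -> (forall x, u <= x <= v -> 0 < f x) ->
  exists m, 0 < m /\ forall x, u <= x <= v -> m <= f x.
Proof.
  intros Huv Hc Hp.
  destruct (continuity_ab_min f u v Huv) as [x0 [H1 H2]].
  - intros x _. apply continuity_pt_filterlim. apply Hc.
  - exists (f x0). split; [now apply Hp | exact H1].
Qed.

Lemma continuous_abs_bound (g : R -> R) (x eta : R) :
  continuous g x -> 0 < eta ->
  exists r, 0 < r /\ forall y, Rabs (y - x) < r -> Rabs (g y - g x) < eta.
Proof.
  intros Hg Heta.
  destruct (proj1 (filterlim_locally g (g x)) Hg (mkposreal eta Heta)) as [r Hr].
  exists r. split; [apply cond_pos | exact Hr].
Qed.

Lemma ergodic_sol_of_solves (V phi : R -> R) (eps c : R) :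
  solves_ergodic (fun x => - V x) eps c phi ->
  ergodic_sol eps (- c) V phi (Derive phi) (Derive_n phi 2).
Proof.
  intros [Hd He]. split; [|split]; intros x.
  - apply Derive_correct, Hd.
  - apply (Derive_correct (Derive phi)), Hd.
  - specialize (He x). lra.
Qed.

(* Only values of [eps] for which [A omega > 0] at the relevant scales are used: the well at
   [1/2] is then the lower one. *)
Lemma limit_drop (rho A : R) (V : R -> R) (c : R -> R) (phi : R -> R -> R) (g : R -> R)
  (Hrho : 0 < rho < / 20) (HA : A <> 0) (HArho : 2 * Rabs A * rho ^ 2 <= / 4)
  (HVper : periodic1 V) (HVcont : forall x, continuous V x)
  (HV0 : V 0 = 0)
  (HVnear0 : forall x, 0 < Rabs x < rho ->
      V x = / 2 * x ^ 2 + A * x ^ 4 * omega (Rabs x))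
  (HVa : V (/ 2) = 0)
  (HVneara : forall x, 0 < Rabs x < rho ->
      V (/ 2 + x) = / 2 * x ^ 2 - A * x ^ 4 * omega (Rabs x))
  (HVpos : forall x, 0 < x < / 2 -> 0 < V x /\ 0 < V (- x))
  (Hphi : forall eps, 0 < eps < 1 ->
      periodic1 (phi eps) /\ solves_ergodic (fun x => - V x) eps (c eps) (phi eps))
  (Hgcont : forall x, continuous g x)
  (Hconv : forall eta, 0 < eta -> exists delta, 0 < delta /\
      forall eps, 0 < eps < 1 -> eps < delta -> forall x, Rabs (phi eps x - g x) < eta) :
  g (/ 2) < g 0.
Proof.
  set (a := Rabs A) in *.
  assert (Ha : 0 < a) by (apply Rabs_pos_lt; exact HA).
  assert (Hsg : exists sg, (sg = 1 \/ sg = -1) /\ A = sg * a).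
  { unfold a. destruct (Rle_or_lt 0 A).
    - exists 1. rewrite Rabs_pos_eq by lra. lra.
    - exists (-1). rewrite Rabs_left by lra. lra. }
  destruct Hsg as [sg [Hsg HsgA]].
  assert (Habs : forall s x, s = 1 \/ s = -1 -> 0 <= x -> Rabs (s * x) = x).
  { intros s x [Hs|Hs] Hx; subst s.
    - rewrite Rmult_1_l. now apply Rabs_pos_eq.
    - replace (-1 * x) with (- x) by ring. rewrite Rabs_Ropp. now apply Rabs_pos_eq. }
  assert (Hpow : forall s x, s = 1 \/ s = -1 -> (s * x) ^ 2 = x ^ 2 /\ (s * x) ^ 4 = x ^ 4).
  { intros s x [Hs|Hs]; subst s; split; ring. }
  assert (HN0 : forall s x, s = 1 \/ s = -1 -> 0 < x < rho ->
    V (0 + s * x) = / 2 * x ^ 2 + a * x ^ 4 * (sg * omega x)).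
  { intros s x Hs Hx. rewrite Rplus_0_l, HVnear0 by (rewrite Habs; lra).
    rewrite Habs by lra. destruct (Hpow s x Hs) as [-> ->]. rewrite HsgA. ring. }
  assert (HNa : forall s x, s = 1 \/ s = -1 -> 0 < x < rho ->
    V (/ 2 + s * x) = / 2 * x ^ 2 - a * x ^ 4 * (sg * omega x)).
  { intros s x Hs Hx. rewrite HVneara by (rewrite Habs; lra).
    rewrite Habs by lra. destruct (Hpow s x Hs) as [-> ->]. rewrite HsgA. ring. }
  assert (Hom : forall x, -1 <= sg * omega x <= 1).
  { intros x. unfold omega. generalize (SIN_bound (ln (ln (/ x)))).
    destruct Hsg; subst sg; lra. }
  assert (Hax : forall x, 0 <= x -> 0 <= a * x ^ 4)
    by (intros x Hx; apply Rmult_le_pos; [lra | apply pow_le; lra]).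
  assert (Hquad : forall x, 0 <= x < rho -> a * x ^ 4 <= / 8 * x ^ 2).
  { intros x Hx. replace (a * x ^ 4) with (a * x ^ 2 * x ^ 2) by ring.
    apply Rmult_le_compat_r; [nra|].
    assert (x ^ 2 <= rho ^ 2) by nra. nra. }
  assert (HL0 : forall s x, s = 1 \/ s = -1 -> 0 <= x < rho ->
    / 2 * x ^ 2 - a * x ^ 4 <= V (0 + s * x)).
  { intros s x Hs [[Hx|Hx] Hx'].
    - rewrite HN0 by (trivial; lra). specialize (Hom x). specialize (Hax x (Rlt_le _ _ Hx)). nra.
    - subst x. replace (0 + s * 0) with 0 by ring. rewrite HV0. lra. }
  assert (HLa : forall s x, s = 1 \/ s = -1 -> 0 <= x < rho ->
    / 2 * x ^ 2 - a * x ^ 4 <= V (/ 2 + s * x) <= / 2 * x ^ 2 + a * x ^ 4).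
  { intros s x Hs [[Hx|Hx] Hx'].
    - rewrite HNa by (trivial; lra). specialize (Hom x). specialize (Hax x (Rlt_le _ _ Hx)).
      split; nra.
    - subst x. replace (/ 2 + s * 0) with (/ 2) by ring. rewrite HVa. lra. }
  assert (Hm : exists m, 0 < m /\ forall s x, s = 1 \/ s = -1 ->
    rho / 2 <= x <= / 2 - rho / 2 -> m <= V (0 + s * x)).
  { destruct (positive_lower_bound V (rho / 2) (/ 2 - rho / 2)) as [m1 [Hm1 Hm1']];
      [lra | exact HVcont | intros x Hx; apply HVpos; lra |].
    destruct (positive_lower_bound V (- (/ 2 - rho / 2)) (- (rho / 2))) as [m2 [Hm2 Hm2']];
      [lra | exact HVcont | |].
    { intros x Hx. rewrite <- (Ropp_involutive x). apply HVpos; lra. }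
    exists (Rmin m1 m2). split; [now apply Rmin_pos|].
    intros s x [Hs|Hs] Hx; subst s.
    - apply Rle_trans with (1 := Rmin_l _ _). apply Hm1'. lra.
    - apply Rle_trans with (1 := Rmin_r _ _). apply Hm2'. lra. }
  destruct Hm as [m [Hm HVm]].
  (* [dl] is the drop over [[rho / 4, rho / 2]] at [al = / 4]. Four errors of size [dl / 8] will use
     up only half of it. *)
  pose (dl := rho ^ 2 / 128).
  assert (Hdl : 0 < dl) by (unfold dl; nra).
  destruct (Hconv (dl / 8)) as [delta [Hdelta Hclose]]; [lra|].
  destruct (continuous_abs_bound g 0 (dl / 8) (Hgcont 0)) as [r0 [Hr0 Hg0]]; [lra|].
  destruct (continuous_abs_bound g (/ 2) (dl / 8) (Hgcont (/ 2))) as [ra [Hra Hga]]; [lra|].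
  pose (b := Rmin (a / 272) (/ 20)).
  assert (Hb : 0 < b) by (unfold b; apply Rmin_pos; lra).
  assert (Hb1 : 272 * b <= a) by (generalize (Rmin_l (a / 272) (/ 20)); unfold b; lra).
  assert (Hb2 : b <= / 20) by apply Rmin_r.
  (* The first two bounds give the smallness needed at the wells. The others keep [e] below [delta],
     [m] and the scale of the drop, and put the distances [q] and [2 q^2] within the continuity
     radii of [g]. *)
  assert (Hq0 : exists q0, 0 < q0 /\ q0 <= b / 1000 /\ q0 <= 3 * b / (a + 20 * b) /\
    q0 <= delta /\ q0 <= m /\ q0 <= rho ^ 2 / 200 /\ q0 <= r0 /\ q0 <= ra / 2).
  { exists (Rmin (b / 1000) (Rmin (3 * b / (a + 20 * b)) (Rmin delta (Rmin m
      (Rmin (rho ^ 2 / 200) (Rmin r0 (ra / 2))))))).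
    split.
    - repeat apply Rmin_pos; try lra; [apply Rdiv_lt_0_compat; lra | nra].
    - repeat split; try apply Rmin_l;
        repeat (try apply Rmin_l; try apply Rmin_r; eapply Rle_trans; [apply Rmin_r|]);
        try apply Rmin_l; try apply Rmin_r; apply Rle_refl. }
  destruct Hq0 as [q0 [Hq0 [Q1 [Q2 [Q3 [Q4 [Q5 [Q6 Q7]]]]]]]].
  destruct (omega_plateau sg q0 Hsg Hq0) as [q [[Hq Hqq0] Hplat]].
  assert (Hq1 : q < 1) by lra.
  assert (Hqab : a * q + 20 * b * q <= 3 * b).
  { assert (q * (a + 20 * b) <= 3 * b); [|lra].
    apply Rle_trans with (3 * b / (a + 20 * b) * (a + 20 * b)).
    - apply Rmult_le_compat_r; lra.
    - right. field. lra. }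
  assert (Hbq : 0 < b * q <= b * / 20) by (split; [nra | apply Rmult_le_compat_l; lra]).
  (* The viscosity is [q ^ 4], so the plateau of [omega] is [[e, e^(1/4)]], around the scale
     [sqrt e = q ^ 2]. *)
  set (e := q ^ 4) in *.
  assert (Hq2 : 0 < q ^ 2 < q) by nra.
  assert (Heq2 : e = q ^ 2 * q ^ 2) by (unfold e; ring).
  assert (He : 0 < e < q) by (rewrite Heq2; nra).
  assert (Hrho2 : rho ^ 2 <= rho) by nra.
  destruct (Hphi e) as [Hper Hsol]; [lra|].
  apply ergodic_sol_of_solves in Hsol.
  set (lam := - c e) in *. set (p0 := phi e) in *.
  specialize (Hclose e ltac:(lra) ltac:(lra)). fold p0 in Hclose.
  assert (Hlam : lam <= e - 6 * b * e ^ 2).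
  (* On at least one side of the well [/ 2] the outward slope is nonnegative; the trial function is
     placed on that side. *)
  { assert (Hs : exists s, (s = 1 \/ s = -1) /\ 0 <= s * Derive p0 (/ 2)).
    { destruct (Rle_or_lt 0 (Derive p0 (/ 2))); [exists 1 | exists (-1)]; lra. }
    destruct Hs as [s [Hs Hs0]].
    assert (Hss : s * s = 1) by (destruct Hs; subst s; ring).
    apply (eigenvalue_low_well a b q lam _ _ _ _ Hb Hb2 Hb1 Hq Hq1 ltac:(lra) ltac:(lra)
             (ergodic_sol_affine e lam (/ 2) s _ _ _ _ Hss Hsol)).
    - intros y Hy. fold e in Hy. rewrite HNa by (trivial; lra).
      specialize (Hplat y Hy). specialize (Hax y ltac:(lra)). nra.
    - intros y Hy. fold e in Hy. apply HLa; [trivial | lra].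
    - replace (/ 2 + s * 0) with (/ 2) by ring. exact Hs0. }
  assert (Hle : lam <= e) by nra.
  (* From [0] the solution is followed in a direction where its initial slope is nonpositive. *)
  assert (Hs : exists s, (s = 1 \/ s = -1) /\ s * Derive p0 0 <= 0).
  { destruct (Rle_or_lt (Derive p0 0) 0); [exists 1 | exists (-1)]; lra. }
  destruct Hs as [s [Hs Hs0]].
  assert (Hss : s * s = 1) by (destruct Hs; subst s; ring).
  assert (HS := ergodic_sol_affine e lam 0 s _ _ _ _ Hss Hsol).
  assert (Hpq : s * Derive p0 (0 + s * q) <= 0).
  { apply (slope_high_well a b q lam _ _ _ _ Hb Ha Hq Hq1 ltac:(lra) ltac:(lra) ltac:(lra) HS).
    - intros x Hx. fold e in Hx. rewrite HN0 by (trivial; lra).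
      specialize (Hplat x Hx). specialize (Hax x ltac:(lra)). nra.
    - intros x Hx. fold e in Hx. apply HL0; [trivial | lra].
    - exact Hlam.
    - replace (0 + s * 0) with 0 by ring. exact Hs0. }
  (* Near the wells [V >= 3/8] of the squared distance, and in the middle [V >= m]. Stopping at
     distance [2 q^2] from [/ 2] leaves [V >= 3/2 e], above [lam]. *)
  assert (HVlam : forall x, q <= x <= / 2 - 2 * q ^ 2 -> lam <= V (0 + s * x)).
  { intros x Hx. apply Rle_trans with (1 := Hle).
    destruct (Rle_or_lt x (rho / 2)) as [Hc1|Hc1];
      [|destruct (Rle_or_lt x (/ 2 - rho / 2)) as [Hc2|Hc2]].
    - assert (H1 := HL0 s x Hs ltac:(lra)). assert (H2 := Hquad x ltac:(lra)).
      assert (q ^ 2 <= x ^ 2) by nra. nra.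
    - specialize (HVm s x Hs ltac:(lra)). lra.
    - rewrite periodic1_opposite by trivial.
      assert (Hs' : - s = 1 \/ - s = -1) by lra.
      destruct (HLa (- s) (/ 2 - x) Hs' ltac:(lra)) as [H1 _].
      assert (H2 := Hquad (/ 2 - x) ltac:(lra)).
      assert ((2 * q ^ 2) ^ 2 <= (/ 2 - x) ^ 2) by (apply pow_incr; lra). nra. }
  assert (Hmono := nonincreasing_of_confinement e lam q (/ 2 - 2 * q ^ 2) _ _ _ _
                     ltac:(lra) HS HVlam Hpq).
  cbv beta in Hmono.
  destruct (Hmono q (rho / 4)) as [D1 D2]; try lra.
  destruct (Hmono (rho / 2) (/ 2 - 2 * q ^ 2)) as [_ D3]; try lra.
  (* On this interval [V >= 3 rho^2 / 128], and [lam <= e < rho^2 / 200], so a margin [rho^2 / 64]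
     remains. *)
  assert (D4 := drop_of_confinement e lam (rho ^ 2 / 64) (/ 4) (rho / 4) (rho / 2) _ _ _ _
                  ltac:(lra) ltac:(lra) HS).
  cbv beta in D4.
  assert (D5 : p0 (0 + s * (rho / 2)) <= p0 (0 + s * (rho / 4)) - / 4 * (rho / 2 - rho / 4) ^ 2 / 2).
  { apply D4; try lra.
    intros x Hx. assert (H1 := HL0 s x Hs ltac:(lra)). assert (H2 := Hquad x ltac:(lra)).
    assert ((rho / 4) ^ 2 <= x ^ 2) by (apply pow_incr; lra). lra. }
  assert (G1 := Hclose (0 + s * q)).
  assert (G2 := Hclose (/ 2 + - s * (2 * q ^ 2))).
  rewrite (periodic1_opposite p0 s (/ 2 - 2 * q ^ 2) Hper Hs) in D3.
  replace (/ 2 - (/ 2 - 2 * q ^ 2)) with (2 * q ^ 2) in D3 by ring.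
  assert (G3 : Rabs (g (0 + s * q) - g 0) < dl / 8).
  { apply Hg0. replace (0 + s * q - 0) with (s * q) by ring. rewrite Habs by (trivial; lra). lra. }
  assert (G4 : Rabs (g (/ 2 + - s * (2 * q ^ 2)) - g (/ 2)) < dl / 8).
  { apply Hga. replace (/ 2 + - s * (2 * q ^ 2) - / 2) with (- s * (2 * q ^ 2)) by ring.
    rewrite Habs by lra. lra. }
  apply Rabs_lt_between in G1, G2, G3, G4.
  unfold dl in *. lra.
Qed.

(** * Exchange of the two wells and contradiction *)

Theorem theorem1p1 (rho A : R) (V : R -> R)
  (c : R -> R) (phi : R -> R -> R)
  (Hrho : 0 < rho < / 20)
  (HA : A <> 0) (HArho : 2 * Rabs A * rho ^ 2 <= / 4)
  (HVper : periodic1 V) (HVC3 : Cn 3 V)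
  (HV0 : V 0 = 0)
  (HVnear0 : forall x, 0 < Rabs x < rho ->
      V x = / 2 * x ^ 2 + A * x ^ 4 * omega (Rabs x))
  (HVa : V (/ 2) = 0)
  (HVneara : forall x, 0 < Rabs (x - / 2) < rho ->
      V x = / 2 * (x - / 2) ^ 2 - A * (x - / 2) ^ 4 * omega (Rabs (x - / 2)))
  (HVpos : forall x, ~ cong1 x 0 -> ~ cong1 x (/ 2) -> 0 < V x)
  (Hphi : forall eps, 0 < eps < 1 ->
      periodic1 (phi eps) /\ phi eps 0 = 0 /\
      solves_ergodic (fun x => - V x) eps (c eps) (phi eps)) :
  ~ converges_CT phi.
Proof.
  intros [g [Hgper [Hgcont Hconv]]].
  assert (HVcont : forall x, continuous V x).
  { intros x. apply (ex_derive_continuous (V := R_NormedModule)).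
    exact (proj1 HVC3 1%nat x ltac:(lia)). }
  assert (HVpos' : forall x, 0 < x < / 2 -> 0 < V x /\ 0 < V (- x)).
  { intros x Hx.
    assert (Hne : forall k, x <> IZR k).
    { intros k E. assert (0 < k)%Z by (apply lt_IZR; lra).
      assert (k < 1)%Z by (apply lt_IZR; lra). lia. }
    assert (Hne' : forall k, x <> / 2 + IZR k).
    { intros k E. assert (-1 < k)%Z by (apply lt_IZR; lra).
      assert (k < 0)%Z by (apply lt_IZR; lra). lia. }
    split; apply HVpos; intros [k E].
    - apply (Hne k). lra.
    - apply (Hne' k). lra.
    - apply (Hne (- k)%Z). rewrite opp_IZR. lra.
    - apply (Hne' (- k - 1)%Z). rewrite minus_IZR, opp_IZR. lra. }
  assert (HVneara' : forall x, 0 < Rabs x < rho ->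
      V (/ 2 + x) = / 2 * x ^ 2 - A * x ^ 4 * omega (Rabs x)).
  { intros x Hx. assert (E : / 2 + x - / 2 = x) by ring.
    rewrite HVneara; rewrite E; trivial. }
  assert (H1 : g (/ 2) < g 0).
  { apply (limit_drop rho A V c phi g); trivial.
    intros eps Heps. destruct (Hphi eps Heps) as [P1 [_ P2]]. now split. }
  (* Translation by half a period swaps the wells and turns [A] into [- A], so the same drop holds
     in the opposite direction: [g 0 < g (/ 2)] by periodicity. The factor [1] matches
     [ergodic_sol_affine] at [s = 1]. *)
  assert (H2 : g (/ 2 + 1 * / 2) < g (/ 2 + 1 * 0)).
  { assert (Haff : forall f : R -> R, (forall x, continuous f x) ->
      forall x, continuous (fun y => f (/ 2 + 1 * y)) x).
    { intros f Hf x. apply (continuous_comp (fun y => / 2 + 1 * y) f); [|apply Hf].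
      apply (ex_derive_continuous (V := R_NormedModule)). auto_derive. trivial. }
    assert (Hsh : forall f, periodic1 f -> periodic1 (fun y => f (/ 2 + 1 * y))).
    { intros f Hf x. rewrite <- (Hf (/ 2 + 1 * x)). f_equal. ring. }
    apply (limit_drop rho (- A) (fun y => V (/ 2 + 1 * y)) c
             (fun eps y => phi eps (/ 2 + 1 * y)) (fun y => g (/ 2 + 1 * y))); auto.
    - lra.
    - now rewrite Rabs_Ropp.
    - replace (/ 2 + 1 * 0) with (/ 2) by ring. exact HVa.
    - intros x Hx. rewrite Rmult_1_l, HVneara' by exact Hx. ring.
    - replace (/ 2 + 1 * / 2) with (0 + 1) by field. now rewrite HVper.
    - intros x Hx. replace (/ 2 + 1 * (/ 2 + x)) with (x + 1) by field.
      rewrite HVper, HVnear0 by exact Hx. ring.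
    - intros x Hx. split.
      + replace (/ 2 + 1 * x) with (- (/ 2 - x) + 1) by field.
        rewrite HVper. apply HVpos'. lra.
      + replace (/ 2 + 1 * - x) with (/ 2 - x) by ring. apply HVpos'. lra.
    - intros eps Heps. destruct (Hphi eps Heps) as [P1 [_ P2]]. split; [now apply Hsh|].
      destruct (ergodic_sol_affine eps (- c eps) (/ 2) 1 V _ _ _ ltac:(ring)
                  (ergodic_sol_of_solves V _ _ _ P2)) as [S0 [S1 S2]].
      assert (E1 : forall x, Derive (fun y => phi eps (/ 2 + 1 * y)) x
                             = 1 * Derive (phi eps) (/ 2 + 1 * x))
        by (intros x; now apply is_derive_unique).
      assert (S1' : forall x, is_derive (Derive (fun y => phi eps (/ 2 + 1 * y))) x
                             (Derive_n (phi eps) 2 (/ 2 + 1 * x))).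
      { intros x. apply is_derive_ext with (2 := S1 x). intros t. now rewrite E1. }
      split; intros x.
      + split; eexists; [apply S0 | apply S1'].
      + specialize (S2 x). rewrite <- E1 in S2.
        replace (Derive_n (fun y => phi eps (/ 2 + 1 * y)) 2 x)
          with (Derive_n (phi eps) 2 (/ 2 + 1 * x))
          by (symmetry; exact (is_derive_unique _ _ _ (S1' x))).
        lra.
    - intros eta Heta. destruct (Hconv eta Heta) as [delta [Hd Hc]].
      exists delta. split; [exact Hd|]. intros eps He1 He2 x. now apply Hc. }
  replace (/ 2 + 1 * / 2) with (0 + 1) in H2 by field.
  rewrite Hgper in H2. replace (/ 2 + 1 * 0) with (/ 2) in H2 by ring.
  lra.
Qed.
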